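(* Let $\lambda,\mu,\kappa$ be cardinals with $\lambda>\mu\ge\operatorname{cf}(\lambda)=\kappa$ and assume $\operatorname{cov}(\lambda,\mu,\kappa,2)=\lambda$. If $\langle P,\le\rangle$ is a poset of cofinality $\lambda$, then $P$ contains a stable subset.
   Context: A cardinal $\lambda$ with $\lambda>\operatorname{cf}(\lambda)$ is a singular (in particular infinite) cardinal. For a set $A$ and a cardinal $\mu$, $[A]^{<\mu}:=\{X\subseteq A\mid |X|<\mu\}$ and $[A]^{\mu}:=\{X\subseteq A\mid |X|=\mu\}$. For cardinals $\lambda\ge\kappa\ge\sigma>1$ and $\mu\ge\kappa+\aleph_0$, let $$\operatorname{cov}(\lambda,\mu,\kappa,\sigma):=\min\{|D|\mid D\subseteq[\lambda]^{<\mu},\ \forall A\in[\lambda]^{<\kappa}\ \exists B\in[D]^{<\sigma}\ (A\subseteq\bigcup B)\}.$$ Let $\langle P,\le\rangle$ be a poset (partially ordered set). For $A\subseteq P$, the downward closure of $A$ is $\underline{A}:=\{x\in P\mid\exists y\in A\,(x\le y)\}$, the upward closure of $A$ is $\overline{A}:=\{x\in P\mid\exists y\in A\,(y\le x)\}$, and the external cofinality of $A$ is $\operatorname{cf}_P(A):=\min\{|B|\mid B\subseteq P,\ A\subseteq\underline{B}\}$. The cofinality of the poset is $\operatorname{cf}(P,\le)=\operatorname{cf}_P(P)$. Stable subset: for $P$ of cofinality $\lambda>\operatorname{cf}(\lambda)=\kappa$, a subset $P'\in[P]^\lambda$ is stable iff $\operatorname{cf}_P(P'\setminus\overline{X})=\lambda$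 for all $X\in[P']^{<\kappa}$. *)

(* Defs.v *)
From mathcomp Require Import all_boot all_order.
From mathcomp Require Import boolp classical_sets functions cardinality wochoice.

Set Implicit Arguments.
Unset Strict Implicit.
Unset Printing Implicit Defensive.

Import Order.TTheory.
Local Open Scope classical_set_scope.
Local Open Scope card_scope.
Local Open Scope order_scope.

Definition card_lt T U (A : set T) (B : set U) : bool :=
  (A #<= B) && ~~ (B #<= A).

Reserved Notation "A '#<' B" (at level 79, format "A  '#<'  B").
Notation "A '#<' B" := (card_lt A B) : card_scope.

(* A cardinal is an initial ordinal: a well-order all of whose proper initial
   segments have strictly smaller cardinality. Two such well-orders of the same
   cardinality are isomorphic but not Leibniz equal, so cardinals are compared
   through #=, #<= and #< on their underlying sets. *)
Record cardinal := Cardinal {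
  card_disp : Order.disp_t;
  card_sort :> orderType card_disp;
  card_wo : well_order (<=%O : rel card_sort);
  card_initial : forall x : card_sort, [set y | y < x] #< [set: card_sort] }.

Lemma ord_wo n : well_order (<=%O : rel 'I_n).
Proof.
apply: antisymmetric_well_order; first exact: le_anti.
move=> A [x Ax].
have := @arg_minnP _ x (mem A) (fun i : 'I_n => nat_of_ord i) Ax.
case=> m Am mP; by exists m; split.
Qed.

Lemma ord_initial n (x : 'I_n) : [set y : 'I_n | y < x] #< [set: 'I_n].
Proof.
apply/andP; split; first exact/subset_card_le.
apply/negP => /card_leP[f].
pose g (y : 'I_n) : 'I_n := val (f (SigSub (mem_set (I : [set: 'I_n] y)))).
have g_inj : injective g.
  move=> y z /val_inj gyz; have := inj (f := f) _ _ gyz.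
  by rewrite !in_setT => /(_ isT isT)/(congr1 val).
have [h _ hK] := injF_bij g_inj.
have : g (h x) < x by exact: (set_mem (valP (f _))).
by rewrite hK ltxx.
Qed.

Definition fin_cardinal (n : nat) : cardinal :=
  Cardinal (@ord_wo n) (@ord_initial n).

(* [min_card F c] : the cardinal c is the minimum of the |X|, X in F. *)
Definition min_card T (F : set (set T)) (c : cardinal) : Prop :=
  (exists2 X, F X & X #= [set: c]) /\ (forall X, F X -> [set: c] #<= X).

(* [A]^{<c} and [A]^c *)
Definition subsets_lt T (A : set T) (c : cardinal) : set (set T) :=
  [set X | X `<=` A /\ X #< [set: c]].

Definition subsets_eq T (A : set T) (c : cardinal) : set (set T) :=
  [set X | X `<=` A /\ X #= [set: c]].

(* [is_cov lambda mu kappa sigma c] : cov(lambda, mu, kappa, sigma) = c, meant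
   for lambda >= kappa >= sigma > 1 and mu >= kappa + aleph_0. *)
Definition is_cov (lambda mu kappa sigma c : cardinal) : Prop :=
  min_card [set D : set (set lambda) |
    D `<=` subsets_lt [set: lambda] mu /\
    forall A, subsets_lt [set: lambda] kappa A ->
      exists2 B, subsets_lt D sigma B & A `<=` \bigcup_(b in B) b] c.

Section Poset.
Context {d : Order.disp_t} {P : porderType d}.
Implicit Types A : set P.

(* The dual of the library's [down]. *)
Definition up A : set P := [set x | exists y, A y /\ y <= x].

(* [is_ext_cf A c] : cf_P(A) = c. *)
Definition is_ext_cf A (c : cardinal) : Prop :=
  min_card [set B | A `<=` down B] c.

Definition stable (lambda kappa : cardinal) (P' : set P) : Prop :=
  subsets_eq [set: P] lambda P' /\
  forall X, subsets_lt P' kappa X -> is_ext_cf (P' `\` up X) lambda.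

End Poset.

(* [is_cf P c] : cf(P, <=) = c. For an infinite cardinal, taken with its ordinal
   order, a set is cofinal in this sense iff it is unbounded, so that
   [is_cf lambda kappa] also expresses cf(lambda) = kappa. *)
Definition is_cf {d : Order.disp_t} (P : porderType d) (c : cardinal) : Prop :=
  is_ext_cf [set: P] c.

(* Main.v *)
(* Let [C] be cofinal in [P] with |C| = lambda, and call a subset of [P] null if
   fewer than lambda elements of [P] dominate it. By the covering hypothesis,
   lambda many sets [a x] of size < mu suffice to cover all the subsets of [C] of
   size < kappa. Given [E], fewer than lambda many sets [C \ up (a x \ down E)],
   each dominated by few elements, cannot cover [C]: some [p] in [C] lies above a
   member of each of the corresponding [a x \ down E]. Letting the bounds run
   through a cofinal subset of lambda and adding all these [p] to [E] strictly
   shrinks every [a x \ down E] whose remainder [C \ up (a x \ down E)] is null.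
   As |a x| < mu, after mu such steps no remainder is null, and |E| <= mu. Then
   [C \ down E] is stable: its subsets of size < kappa are contained in some
   [a x \ down E], and [down E] is null. *)
Require Import Defs.
From mathcomp Require Import all_boot all_order.
From mathcomp Require Import boolp classical_sets functions cardinality wochoice.

Set Implicit Arguments.
Unset Strict Implicit.
Unset Printing Implicit Defensive.

Import Order.TTheory.
Local Open Scope order_scope.
Local Open Scope classical_set_scope.
Local Open Scope card_scope.

(** * Injections and comparability of cardinalities *)

Lemma card_le_funP T U (u0 : U) (A : set T) (B : set U) :
  A #<= B <-> exists2 f : T -> U, set_fun A B f & {in A &, injective f}.
Proof.
elim/Ppointed: U => U in u0 B *; first by have := no u0.
split; first by move=> /pcard_leP/injfunPex.
by move=> /injfunPex/pcard_leP.
Qed.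

(* Stated with a relation so that the target type may be empty. *)
Lemma rel_card_le T U (A : set T) (B : set U) (R : T -> U -> Prop) :
  (forall x, A x -> exists2 y, B y & R x y) ->
  (forall x x' y, A x -> A x' -> R x y -> R x' y -> x = x') -> A #<= B.
Proof.
move=> Rtot Rinj; have [->//|/set0P[x0 /Rtot[u0 _ _]]] := eqVneq A set0.
have [f fP] : {f : T -> U & forall x, A x -> B (f x) /\ R x (f x)}.
  apply: (@choice T U (fun x y => A x -> B y /\ R x y)) => x.
  have [/Rtot[y By Rxy]|NAx] := pselect (A x); first by exists y.
  by exists u0 => /NAx.
apply/(card_le_funP u0); exists f => [x /fP[]//|x y].
rewrite !inE => Ax Ay fxy; apply: (Rinj _ _ (f y)) => //; last by case: (fP _ Ay).
by rewrite -fxy; case: (fP _ Ax).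
Qed.

(** One equivalence holds both conditions: from left to right [G] is single-valued, from right to
    left it is injective. *)
Definition partial_inj T U (G : set (T * U)) :=
  forall p q, G p -> G q -> p.1 = q.1 <-> p.2 = q.2.

Lemma partial_inj_bigcup T U (F : set (set (T * U))) :
  total_on F subset -> (forall G, F G -> partial_inj G) ->
  partial_inj (\bigcup_(G in F) G).
Proof.
move=> Ftot Finj p q [G FG Gp] [H FH Hq].
have [GH|HG] := Ftot _ _ FG FH; first exact: Finj FH _ _ (GH _ Gp) Hq.
exact: Finj FG _ _ Gp (HG _ Hq).
Qed.

(** Zorn yields a maximal graph of a partial injection from [A] to [B]. If it missed some [x] in [A]
    and some [y] in [B], the pair [(x, y)] could be added. *)
Lemma card_le_total T U (A : set T) (B : set U) : A #<= B \/ B #<= A.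
Proof.
have [|G [[GAB Ginj] Gmax]] := @Zorn_bigcup (T * U)
    [set G | G `<=` A `*` B /\ partial_inj G].
  move=> F FP Ftot; split; first by apply: bigcup_sub => G /FP[].
  by apply: partial_inj_bigcup Ftot _ => G /FP[].
have [AG|/existsNP[x /not_implyP[Ax NGx]]] :=
  pselect (forall x, A x -> exists y, G (x, y)).
  left; apply: (@rel_card_le _ _ _ _ (fun x y => G (x, y))).
    by move=> x /AG[y Gxy]; exists y => //; case: (GAB _ Gxy).
  by move=> x x' y _ _ Gxy Gx'y; apply/(Ginj _ _ Gxy Gx'y).
right; apply: (@rel_card_le _ _ _ _ (fun y x => G (x, y))); last first.
  by move=> y y' z _ _ Gxy Gx'y; apply/(Ginj _ _ Gxy Gx'y).
move=> y By; apply: contrapT => NGy.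
have {}NGy z : ~ G (z, y).
  by move=> Gzy; apply: NGy; exists z => //; case: (GAB _ Gzy).
apply: (Gmax (G `|` [set (x, y)])).
  split; first exact: subsetUl.
  by move=> /(_ (x, y)) GU; apply: NGx; exists y; apply: GU; right.
split; first by rewrite subUset; split=> // _ ->.
move=> [x1 y1] [x2 y2] [G1|[-> ->]] [G2|[-> ->]] //; first exact: Ginj.
- split=> /= E; first by case: NGx; exists y1; rewrite -E.
  by case: (NGy x1); rewrite -E.
- split=> /= E; first by case: NGx; exists y2; rewrite E.
  by case: (NGy x2); rewrite E.
Qed.

Lemma card_ltNge T U (A : set T) (B : set U) : (A #< B) = ~~ (B #<= A).
Proof.
by rewrite /card_lt; have [->|->] := card_le_total A B; rewrite ?andbF //;
   case: (A #<= B).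
Qed.

(** * Products and unions of infinite sets *)

Lemma card_leX T T' U U' (A : set T) (A' : set T') (B : set U) (B' : set U') :
  A #<= A' -> B #<= B' -> A `*` B #<= A' `*` B'.
Proof.
have [->|/set0P[a Aa]] := eqVneq A set0; first by rewrite set0X.
have [->|/set0P[b Bb]] := eqVneq B set0; first by rewrite setX0.
move=> AA' BB'.
have /card_leP[f0] := AA'; pose a' := val (f0 (SigSub (mem_set Aa))).
have /card_leP[g0] := BB'; pose b' := val (g0 (SigSub (mem_set Bb))).
move: AA' BB' => /(card_le_funP a')[f fA finj] /(card_le_funP b')[g gB ginj].
apply/(card_le_funP (a', b')); exists (fun p => (f p.1, g p.2)).
  by move=> [x y] [/= /fA ? /gB].
move=> [x y] [x' y']; rewrite !inE => -[/= Ax By] [/= Ax' By'] [fx gy].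
by rewrite (finj _ _ _ _ fx) ?inE // (ginj _ _ _ _ gy) ?inE.
Qed.

(** The second coordinate is a tag: [n0] marks the elements of [A], [n1] those of [B] outside
    [A]. *)
Lemma card_setU_le_setX T U V (A B : set T) (M : set U) (N : set V) (n0 n1 : V) :
  N n0 -> N n1 -> n0 <> n1 -> A #<= M -> B #<= M -> A `|` B #<= M `*` N.
Proof.
move=> Nn0 Nn1 n01 AM BM.
have [->|/set0P[t ABt]] := eqVneq (A `|` B) set0; first exact: card_ge0.
have [u0] : exists u : U, True.
  by case: ABt => Xt; [have /card_leP[f] := AM|have /card_leP[f] := BM];
     exists (val (f (SigSub (mem_set Xt)))).
move=> _; move: AM BM => /(card_le_funP u0)[f fA finj] /(card_le_funP u0)[g gB ginj].
apply/(card_le_funP (u0, n0)).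
exists (fun x => if x \in A then (f x, n0) else (g x, n1)).
  by move=> x ABx; case: ifPn => [/set_mem/fA|/negP xA] //=; split=> //;
     apply: gB; case: ABx => // /mem_set.
move=> x y; rewrite !in_setU; do 2 case: ifPn => //= ?.
- by move=> _ _ [fxy]; apply: finj.
- by move=> _ _ [_ /n01].
- by move=> _ _ [_ /esym/n01].
- by move=> ? ? [fxy]; apply: ginj.
Qed.

Lemma infinite_two_points T (M : set T) :
  infinite_set M -> exists x y, [/\ M x, M y & x <> y].
Proof.
move=> Minf; have [x Mx] := infinite_setN0 Minf.
have /infinite_setN0[y [My yx]] : infinite_set (M `\` [set x]).
  by apply: infinite_setD => //; exact: finite_set1.
by exists x, y; split=> // xy; apply: yx; rewrite xy.
Qed.

Section SquareInfinite.
Variables (T : Type) (A : set T).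

(* [pairing G]: the relation [G] is the graph of an injection of [M `*` M] into
   [M], where [M := carrier G] is empty or infinite. *)
Let carrier (G : set (T * T * T)) : set T := [set x | exists z, G (x, x, z)].

Let pairing (G : set (T * T * T)) : Prop :=
  [/\ partial_inj G, carrier G `<=` A,
      forall x y z, G (x, y, z) -> [/\ carrier G x, carrier G y & carrier G z],
      forall x y, carrier G x -> carrier G y -> exists z, G (x, y, z) &
      forall x, carrier G x -> infinite_set (carrier G)].

Let pairing_bigcup F : F `<=` pairing -> total_on F subset ->
  pairing (\bigcup_(G in F) G).
Proof.
move=> FP Ftot.
have sub G : F G -> carrier G `<=` carrier (\bigcup_(G in F) G).
  by move=> FG x [z Gz]; exists z, G.
split.
- by apply: partial_inj_bigcup Ftot _ => G /FP[].
- by move=> x [z [G /FP[_ GA _ _ _] Gz]]; apply: GA; exists z.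
- move=> x y z [G FG Gxyz]; have [_ _ /(_ _ _ _ Gxyz)[Gx Gy Gz] _ _] := FP _ FG.
  by split; apply: (sub _ FG).
- move=> x y [x' [G FG Gx]] [y' [H FH Hy]].
  have [GH|HG] := Ftot _ _ FG FH.
    have [_ _ _ /(_ x y)[]] := FP _ FH; [by exists x'; apply: GH|by exists y'|].
    by move=> z Hz _; exists z, H.
  have [_ _ _ /(_ x y)[]] := FP _ FG; [by exists x'|by exists y'; apply: HG|].
  by move=> z Gz _; exists z, G.
- move=> x [z [G FG Gx]]; have [_ _ _ _ /(_ x)] := FP _ FG.
  by move=> /(_ (ex_intro _ z Gx)); apply: sub_infinite_set; apply: sub.
Qed.

(** A copy of the natural numbers inside [A] inherits their coding of pairs. This rules out an empty
    carrier for a maximal [G]. *)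
Let pairing_nat : infinite_set A -> exists2 G, pairing G & G !=set0.
Proof.
move=> /[dup] /infinite_setN0[t0 _] /infiniteP/(card_le_funP t0)[g gA ginj].
pose G : set (T * T * T) :=
  [set p | exists m n, p = (g m, g n, g (choice.pickle (m, n)))].
have {}ginj : injective g by move=> m n; apply: ginj; rewrite inE.
have GE : carrier G = range g.
  apply/seteqP; split=> [x [z [m [n [-> _ _]]]]|_ [m _ <-]]; first by exists m.
  by exists (g (choice.pickle (m, m))); exists m, m.
exists G; last by exists (g 0, g 0, g (choice.pickle (0, 0)))%N; exists 0%N, 0%N.
split; rewrite ?GE.
- move=> _ _ [m [n ->]] [m' [n' ->]] /=; split; first by case=> /ginj-> /ginj->.
  by move=> /ginj/(pcan_inj choice.pickleK)[-> ->].
- by move=> _ [m _ <-]; exact: gA.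
- move=> x y z [m [n [-> -> ->]]]; split; exact: imageT.
- by move=> _ _ [m _ <-] [n _ <-]; exists (g (choice.pickle (m, n))), m, n.
- move=> _ _; apply/infiniteP; apply/(card_le_funP t0); exists g => //.
  by move=> m n _ _ /ginj.
Qed.

Let carrier_square G : pairing G -> carrier G `*` carrier G #<= carrier G.
Proof.
move=> [Ginj _ Gcl Gtot _].
apply: (@rel_card_le _ _ _ _ (fun p z => G (p, z))).
  by move=> [x y] [/= Gx Gy]; have [z Gz] := Gtot _ _ Gx Gy; exists z => //;
     case: (Gcl _ _ _ Gz).
by move=> p q z _ _ Gp Gq; apply/(Ginj _ _ Gp Gq).
Qed.

(* If a maximal [M] had smaller cardinality than [A], then [A \ M] would contain
   a copy [M'] of [M], and the new pairs of [N := M `|` M'] could be mapped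
   injectively into [M']. *)
Lemma card_setX_infinite : infinite_set A -> A `*` A #<= A.
Proof.
move=> Ainf; have [G [Gp Gmax]] := @Zorn_bigcup _ pairing pairing_bigcup.
pose M := carrier G; have MM : M `*` M #<= M := carrier_square Gp.
have [Ginj MA Gcl Gtot Ginf] := Gp.
have Minf : infinite_set M.
  have [M0|/set0P[x /Ginf//]] := eqVneq M set0.
  have [H Hp [p Hp']] := pairing_nat Ainf; case: (Gmax _ _ Hp); split.
    by move=> [[x y] z] /Gcl[]; rewrite -/M M0.
  by move=> /(_ _ Hp'); case: p {Hp'} => [[x y] z] /Gcl[]; rewrite -/M M0.
have [m0 [m1 [Mm0 Mm1 m01]]] := infinite_two_points Minf.
have twoM (B C : set T) : B #<= M -> C #<= M -> B `|` C #<= M.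
  by move=> BM CM; apply: card_le_trans MM; exact: card_setU_le_setX Mm0 Mm1 m01 _ _.
have [DM|MD] := card_le_total (A `\` M) M.
  have AM : A #<= M.
    by have := twoM _ _ (card_lexx M) DM; rewrite setDE setUIr setUv setIT (setUidr MA).
  apply: card_le_trans (card_leX AM AM) _.
  exact: card_le_trans MM (subset_card_le MA).
have [phi phiM phiinj] := (card_le_funP m0 _ _).1 MD.
pose M' := phi @` M; pose N := M `|` M'.
have M'M x : M' x -> ~ M x by move=> [y /phiM[_ H] <-].
have M'card : M' #= M by exact: inj_card_eq.
have NN : N `*` N #<= M'.
  have NM : N #<= M by apply: twoM => //; rewrite (card_le_eql M'card).
  rewrite (card_le_eqr M'card).
  exact: card_le_trans (card_leX NM NM) MM.
have [h hN hinj] := (card_le_funP m0 _ _).1 NN.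
pose H := G `|` [set p | [/\ (N `*` N) p.1, ~ (M `*` M) p.1 & p.2 = h p.1]].
have GM p : G p -> (M `*` M) p.1 /\ M p.2 by case: p => [[x y] z] /Gcl[].
have HE : carrier H = N.
  apply/seteqP; split=> [x [z [/Gcl[Mx _ _]|[[]//]]]|x Nx]; first by left.
  have [Mx|NMx] := pselect (M x).
    by have [z Gz] := Gtot _ _ Mx Mx; exists z; left.
  by exists (h (x, x)); right; split=> // -[].
exfalso; apply: (Gmax H).
  split; first exact: subsetUl.
  move=> HG; have M'phi : M' (phi m0) by exists m0.
  have [|] := GM (phi m0, phi m0, h (phi m0, phi m0)).
    by apply: HG; right; split=> //=; [split; right|case=> /M'M].
  by case=> /M'M.
split; rewrite ?HE.
- move=> p q [Gp'|[Np NMp p2]] [Gq|[Nq NMq q2]].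
  + exact: Ginj.
  + have [Mp1 Mp2] := GM _ Gp'; split=> E; first by rewrite E in Mp1.
    by have /M'M := hN _ Nq; rewrite -q2 -E.
  + have [Mq1 Mq2] := GM _ Gq; split=> E; first by rewrite -E in Mq1.
    by have /M'M := hN _ Np; rewrite -p2 E.
  + rewrite p2 q2; split=> [->//|]; apply: hinj; exact: mem_set.
- by move=> x [/MA//|[y /phiM[Ay _] <-]].
- move=> x y z [/Gcl[]|[[/= Nx Ny] _ ->]]; first by split; left.
  by split=> //; right; apply: hN.
- move=> x y Nx Ny; have [[Mx My]|NM] := pselect ((M `*` M) (x, y)).
    by have [z Gz] := Gtot _ _ Mx My; exists z; left.
  by exists (h (x, y)); right.
- by move=> x Nx; apply: sub_infinite_set Minf; exact: subsetUl.
Qed.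

End SquareInfinite.

Lemma card_setU_le T U (A B : set T) (M : set U) :
  infinite_set M -> A #<= M -> B #<= M -> A `|` B #<= M.
Proof.
move=> Minf AM BM; have [m0 [m1 [Mm0 Mm1 m01]]] := infinite_two_points Minf.
apply: card_le_trans (card_setX_infinite Minf).
exact: card_setU_le_setX Mm0 Mm1 m01 AM BM.
Qed.

(** Each [t] is sent to the code of a chosen index [i_ t] together with its code within [F (i_ t)];
    the square of [M] is no larger than [M]. *)
Lemma card_bigcup_le T I U (M : set U) (D : set I) (F : I -> set T) :
  infinite_set M -> D #<= M -> (forall i, D i -> F i #<= M) ->
  \bigcup_(i in D) F i #<= M.
Proof.
move=> Minf DM FM; have [u0 _] := infinite_setN0 Minf.
have [->|/set0P[_ [i0 _ _]]] := eqVneq (\bigcup_(i in D) F i) set0 => //.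
have [j jM jinj] := (card_le_funP u0 _ _).1 DM.
have [g gP] : {g : I -> T -> U &
    forall i, D i -> set_fun (F i) M (g i) /\ {in F i &, injective (g i)}}.
  apply: (@choice _ _ (fun i h => D i -> set_fun (F i) M h /\ {in F i &, injective h})).
  move=> i; have [/FM/(card_le_funP u0)[h hM hinj]|NDi] := pselect (D i).
    by exists h.
  by exists (fun=> u0) => /NDi.
have [i_ iP] : {i_ : T -> I &
    forall t, (\bigcup_(i in D) F i) t -> D (i_ t) /\ F (i_ t) t}.
  apply: (@choice _ _ (fun t i => (\bigcup_(i in D) F i) t -> D i /\ F i t)) => t.
  have [[i Di Fit]|Nt] := pselect ((\bigcup_(i in D) F i) t); first by exists i.
  by exists i0 => /Nt.
apply: card_le_trans (card_setX_infinite Minf).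
apply/(card_le_funP (u0, u0)); exists (fun t => (j (i_ t), g (i_ t) t)).
  by move=> t /iP[Di Fit]; split=> /=; [exact: jM|case: (gP _ Di) => + _; apply].
move=> t t'; rewrite !inE => /iP[Di Ft] /iP[Di' Ft'] [].
move=> /jinj; rewrite !inE => /(_ Di Di') ii'; rewrite -ii' in Ft' *.
by case: (gP _ Di) => _ ginj /ginj; apply; exact: mem_set.
Qed.

Lemma card_le_lt_trans T U V (B : set U) (A : set T) (C : set V) :
  A #<= B -> B #< C -> A #< C.
Proof.
by move=> AB; rewrite !card_ltNge; apply: contra => CA; exact: card_le_trans AB.
Qed.

(** The larger of the two sets, if infinite, absorbs the other; if it is finite, so is the union,
    whereas [M] is infinite. *)
Lemma card_setU_lt T U (A B : set T) (M : set U) :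
  infinite_set M -> A #< M -> B #< M -> A `|` B #< M.
Proof.
move=> Minf.
wlog AB : A B / A #<= B.
  by move=> H; have [/H//|/H {}H AM BM] := card_le_total A B; rewrite setUC H.
move=> AM BM; have [Bfin|Binf] := pselect (finite_set B); last first.
  exact: card_le_lt_trans (card_setU_le Binf AB (card_lexx B)) BM.
rewrite card_ltNge; apply/negP => MAB; apply: Minf; apply: card_le_finite MAB _.
by rewrite finite_setU; split=> //; apply: card_le_finite AB _.
Qed.

(** [N] provides for a finite [M]: the larger of [M] and [N] is infinite and still below [L]. *)
Lemma card_bigcup_lt T I U V W (L : set U) (N : set V) (M : set W)
    (D : set I) (F : I -> set T) :
  infinite_set N -> N #< L -> M #< L -> D #<= M ->
  (forall i, D i -> F i #<= M) -> \bigcup_(i in D) F i #< L.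
Proof.
move=> Ninf NL ML DM FM; have [MN|NM] := card_le_total M N.
  apply: card_le_lt_trans NL; apply: card_bigcup_le => //.
    exact: card_le_trans DM MN.
  by move=> i /FM FiM; exact: card_le_trans FiM MN.
apply: card_le_lt_trans ML; apply: card_bigcup_le => // Mfin; apply: Ninf.
exact: card_le_finite NM Mfin.
Qed.

Lemma card_eq_range T U (u0 : U) (B : set U) :
  [set: T] #= B -> exists2 f : T -> U, injective f & range f = B.
Proof.
elim/Ppointed: U => U in u0 B *; first by have := no u0.
move=> /card_set_bijP[f [fB finj fsurj]]; exists f.
  by move=> x y; apply: finj; rewrite inE.
by apply/seteqP; split=> [_ [x _ <-]|y /fsurj//]; exact: fB.
Qed.

(** * Recursion and initial segments in a cardinal *)

Section CardinalTheory.
Variable c : cardinal.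

Lemma cardinal_wf : well_founded (fun x y : c => x < y).
Proof.
move=> x; apply: contrapT => NAx.
have [|z [[zN zmin] _]] := @card_wo c [pred z | `[< ~ Acc (fun x y : c => x < y) z >]].
  by exists x; apply/asboolP.
have /asboolP := zN; apply; split=> y yz; apply: contrapT => NAy.
have : z <= y by apply: zmin; apply/asboolP.
by rewrite leNgt yz.
Qed.

Lemma cardinal_rec T (step : set T -> T) :
  exists f : c -> T, forall x, f x = step (f @` [set y | y < x]).
Proof.
pose F x (rec : forall y : c, y < x -> T) :=
  step [set t | exists y (yx : y < x), rec y yx = t].
exists (Fix cardinal_wf (fun=> T) F) => x.
rewrite Fix_eq => [|y g h gh]; last first.
  by congr step; apply/seteqP; split=> t [z [zy <-]]; exists z, zy.
by congr step; apply/seteqP; split=> [t [y [yx <-]]|_ [y yx <-]]; exists y => //;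
  exists yx.
Qed.

(** Otherwise the values chosen before any stage never exhaust [B], so recursion picks a new element
    of [B] at every stage and injects [c] into [B]. *)
Lemma card_lt_segment T (B : set T) :
  B #< [set: c] -> exists x : c, B #<= [set y | y < x].
Proof.
rewrite card_ltNge => cB; apply: contrapT => /forallNP NB.
have [x0 _] : exists x0 : c, True.
  by apply: contrapT => c0; case/negP: cB; apply: (@rel_card_le _ _ _ _ (fun _ _ => True)) => x;
     case: c0; exists x.
have [b0 _] : exists b, B b.
  by apply/set0P/negP => /eqP B0; apply: (NB x0); rewrite B0.
have [step stepP] : {step : set T -> T & forall X, ~ (B `<=` X) -> B (step X) /\ ~ X (step X)}.
  apply: (@choice _ _ (fun X t => ~ (B `<=` X) -> B t /\ ~ X t)) => X.
  have [BX|/existsNP[t /not_implyP[Bt NXt]]] := pselect (B `<=` X); last by exists t.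
  by exists b0.
have [f fE] := cardinal_rec step.
have {}fP x : B (f x) /\ ~ (f @` [set y | y < x]) (f x).
  rewrite fE; apply: stepP => BX; apply: (NB x).
  exact: card_le_trans (subset_card_le BX) (card_image_le _ _).
case/negP: cB; apply/(card_le_funP b0); exists f => [x _|x y _ _].
  by case: (fP x).
by case: (ltgtP x y) => // xy fxy; [case: (fP y)|case: (fP x)] => _ [];
   [exists x|exists y].
Qed.

Hypothesis cinf : infinite_set [set: c].

Lemma card_closed_segment (x : c) : [set y | y <= x] #< [set: c].
Proof.
have -> : [set y | y <= x] = [set y | y < x] `|` [set x].
  apply/seteqP; split=> y /=; last by case=> [/ltW|->].
  by rewrite le_eqVlt => /predU1P[]; [right|left].
apply: card_setU_lt => //; first exact: card_initial.
rewrite card_ltNge; apply/negP => cx; apply: cinf.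
exact: card_le_finite cx (finite_set1 x).
Qed.

(** A finite [K] has an upper bound [m]; the segment up to [m] would then be all of [c], although it
    is smaller. *)
Lemma cofinal_infinite (K : set c) : [set: c] `<=` down K -> infinite_set K.
Proof.
move=> Kcof /finite_seqP[s Ks].
have [x0 _] := infinite_setN0 cinf.
have [m mP] : exists m, forall x, x \in s -> x <= m.
  elim: s {Ks} => [|y s [m mP]]; first by exists x0.
  exists (Order.max y m) => x; rewrite inE le_max => /predU1P[->|/mP->].
    by rewrite lexx.
  by rewrite orbT.
have := card_closed_segment m; rewrite card_ltNge => /negP; apply.
apply: subset_card_le => x _; have [y [Ky xy]] := Kcof x I.
by apply: le_trans xy (mP _ _); rewrite Ks in Ky.
Qed.

End CardinalTheory.

(** * Null sets and the construction of [E] *)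

Section Null.
Variables (lambda : cardinal) (d : Order.disp_t) (P : porderType d).
Hypothesis linf : infinite_set [set: lambda].
Implicit Types S B E C : set P.

(* cf_P(S) < lambda *)
Definition null S := exists2 B : set P, B #< [set: lambda] & S `<=` down B.

Lemma sub_null S S' : S `<=` S' -> null S' -> null S.
Proof. by move=> SS' [B Bl S'B]; exists B => //; exact: subset_trans S'B. Qed.

Lemma null_setU S S' : null S -> null S' -> null (S `|` S').
Proof.
move=> [B Bl SB] [B' B'l S'B']; exists (B `|` B'); first exact: card_setU_lt.
by move=> x [/SB|/S'B'] [y [By xy]]; exists y; split=> //; [left|right].
Qed.

Variables (mu : cardinal) (C : set P) (a : lambda -> set P).
Hypothesis muinf : infinite_set [set: mu].
Hypothesis mu_lt : [set: mu] #< [set: lambda].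
Hypothesis Cpos : ~ null C.

(* Otherwise the union of the dominating sets [B] would dominate [C]. *)
Lemma common_upper_bound (k : lambda) E :
  exists p, C p /\ forall x, x <= k ->
    (exists2 B, B #<= [set y | y <= k] & C `\` up (a x `\` down E) `<=` down B) ->
    up (a x `\` down E) p.
Proof.
pose bad x B := B #<= [set y | y <= k] /\ C `\` up (a x `\` down E) `<=` down B.
apply: contrapT => /forallNP Nub; apply: Cpos.
have [b bP] : {b : lambda -> set P & forall x, (exists B, bad x B) -> bad x (b x)}.
  apply: (@choice _ _ (fun x B => (exists B', bad x B') -> bad x B)) => x.
  have [[B badB]|Nx] := pselect (exists B, bad x B); first by exists B.
  by exists set0 => /Nx.
pose D := [set x | x <= k /\ exists B, bad x B].
exists (\bigcup_(x in D) b x).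
  (* [mu] is the infinite bound below [lambda] in case the segment up to [k] is finite. *)
  apply: (card_bigcup_lt muinf mu_lt (card_closed_segment linf k)).
    by apply: subset_card_le => x [].
  by move=> x [_ /bP[]].
move=> p Cp; have /not_andP[//|/existsNP[x]] := Nub p.
move=> /not_implyP[xk /not_implyP[[B Bk CB] Np]].
have Dx : D x by split=> //; exists B.
have [_ /(_ p)[//|y [bxy py]]] := bP x (ex_intro _ B (conj Bk CB)).
by exists y; split=> //; exists x.
Qed.

Variable K : set lambda.
Hypothesis Kcof : [set: lambda] `<=` down K.
Hypothesis Kmu : K #<= [set: mu].
Hypothesis a_lt : forall x, a x #< [set: mu].

(** Were the remainder at [x] null, every stage [z] would add an element above some [v] in [a x]
    that no earlier addition dominates. Distinct stages have distinct [v], so [mu] would inject into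
    [a x]. *)
Lemma null_remainder :
  exists2 E : set P, E #<= [set: mu] & forall x, ~ null (C `\` up (a x `\` down E)).
Proof.
have [p pP] := choice (fun kE : lambda * set P => common_upper_bound kE.1 kE.2).
have [f fE] := cardinal_rec mu (fun X : set (set P) =>
  (fun k => p (k, \bigcup_(Y in X) Y)) @` K).
(* [f z] is what stage [z] adds; [below z] is what the earlier stages added. *)
pose below z := \bigcup_(Y in f @` [set y | y < z]) Y.
exists (\bigcup_z f z).
  apply: card_bigcup_le => // z _; rewrite fE.
  exact: card_le_trans (card_image_le _ _) Kmu.
move=> x [B /card_lt_segment[y By] CB].
(* Being above [y] makes [k] large enough to bound the size of [B]; being above [x] puts [x] among
   the indices treated. *)
have [k [Kk yxk]] := Kcof (I : [set: lambda] (Order.max y x)).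
move: yxk; rewrite ge_max => /andP[yk xk].
have pf z : f z (p (k, below z)) by rewrite fE; exists k.
have ub z : up (a x `\` down (below z)) (p (k, below z)).
  have [_] := pP (k, below z); apply => //=; exists B.
    by apply: card_le_trans By _; apply: subset_card_le => w /= /ltW/le_trans; apply.
  (* [below z] is part of [E], so the remainder at stage [z] lies within the final one, which [B]
     dominates. *)
  apply: subset_trans CB => w [Cw Nw]; split=> // -[v [[av Nv] vw]]; apply: Nw.
  exists v; split=> //; split=> // -[u [[_ [z' z'z <-] fu] vu]]; apply: Nv.
  by exists u; split=> //; exists z'.
have := a_lt x; rewrite card_ltNge => /negP; apply.
apply: (@rel_card_le _ _ _ _
  (fun z v => v <= p (k, below z) /\ ~ down (below z) v)).
  by move=> z _; have [v [[av Nv] vp]] := ub z; exists v.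
(* The addition of stage [z] belongs to [below z'] for every later [z']. *)
have lt_inj z z' v : z < z' -> v <= p (k, below z) -> ~ ~ down (below z') v.
  move=> zz' vp; apply; exists (p (k, below z)); split=> //.
  by exists (f z) => //; exists z.
move=> z z' v _ _ [vz Nz] [vz' Nz']; case: (ltgtP z z') => // zz'.
  by case: (lt_inj _ _ _ zz' vz).
by case: (lt_inj _ _ _ zz' vz').
Qed.

End Null.

(** * Covers by at most one set, and the stable subset *)

Lemma subsets_lt2_bigcup T (D B : set (set T)) :
  D !=set0 -> subsets_lt D (fin_cardinal 2) B ->
  exists2 A, D A & \bigcup_(X in B) X `<=` A.
Proof.
move=> [A0 DA0] [BD B2].
have [->|/set0P[A BA]] := eqVneq B set0.
  by exists A0 => //; rewrite bigcup_set0.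
exists A; first exact: BD.
move=> x [A' BA' A'x]; have [<-//|AA'] := pselect (A' = A).
(* Two distinct members of [B] would embed ['I_2] into [B]. *)
move: B2; rewrite card_ltNge => /negP[].
apply/(card_le_funP A); exists (fun i : 'I_2 => if i == ord0 then A else A').
  by move=> i _ /=; case: ifP.
move=> i j _ _ ij; have Aij : (i == ord0) = (j == ord0).
  by case: eqP ij => _; case: eqP => _ // E; case: AA'; rewrite E.
apply/val_inj; move: Aij.
by case: i {ij} => -[|[|//]] ?; case: j => -[|[|//]] ?.
Qed.

Theorem corollary2p8 (lambda mu kappa : cardinal)
    (lambda_infinite : infinite_set [set: lambda])
    (mu_lt_lambda : [set: mu] #< [set: lambda])
    (kappa_le_mu : [set: kappa] #<= [set: mu])
    (cf_lambda : is_cf lambda kappa)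
    (cov_lambda : is_cov lambda mu kappa (fin_cardinal 2) lambda)
    (d : Order.disp_t) (P : porderType d) (cf_P : is_cf P lambda) :
  exists P' : set P, stable lambda kappa P'.
Proof.
have [x0 _] := infinite_setN0 lambda_infinite.
have [[C Ccof Cl] Cmin] := cf_P.
have [[K Kcof Kk] _] := cf_lambda.
have [[D [Dmu Dcov] Dl] _] := cov_lambda.
have Kmu : K #<= [set: mu] by rewrite (card_le_eql Kk).
have mu_infinite : infinite_set [set: mu].
  by move=> mufin; apply: (cofinal_infinite lambda_infinite Kcof);
     exact: card_le_finite Kmu mufin.
have Cpos : ~ null lambda C.
  move=> [B]; rewrite card_ltNge => /negP Bl CB; apply: Bl; apply: Cmin => p _.
  have [q [/CB[r [Br qr]] pq]] := Ccof p I.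
  by exists r; split=> //; exact: le_trans qr.
have [p0 Cp0] : C !=set0.
  apply/set0P/negP => /eqP C0; apply: Cpos; exists C => //.
    by rewrite C0 card_ltNge card_le0; apply/negP => /eqP l0; have : set0 x0 by rewrite -l0.
  by rewrite C0.
(* [e] carries the covering family from [lambda] over to [C]. *)
have [e einj eC] : exists2 e : lambda -> P, injective e & range e = C.
  by apply: card_eq_range => //; rewrite card_eq_sym.
have [a _ aD] : exists2 a : lambda -> set lambda, injective a & range a = D.
  by apply: card_eq_range; [exact: set0|rewrite card_eq_sym].
have a_lt x : e @` a x #< [set: mu].
  have [|_ ax] := Dmu (a x); first by rewrite -aD; exists x.
  exact: card_le_lt_trans (card_image_le _ _) ax.
have [E Emu Epos] :=
  null_remainder lambda_infinite mu_infinite mu_lt_lambda Cpos Kcof Kmu a_lt.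
have Enull : null lambda (down E).
  by exists E => //; exact: card_le_lt_trans mu_lt_lambda.
pose P' := C `\` down E; have P'C : P' `<=` C by move=> p [].
have pos_ge (S : set P) : ~ null lambda S -> forall B, S `<=` down B -> [set: lambda] #<= B.
  move=> Spos B SB; apply: contrapT => /negP; rewrite -card_ltNge => Bl.
  by apply: Spos; exists B.
exists P'; split.
  split=> //; apply/card_eqPle; split.
    by apply: card_le_trans (subset_card_le P'C) _; rewrite (card_le_eql Cl).
  (* [C] lies in the union of [P'] and the null set [down E]. As [P'] dominates itself, not being
     null forces its size up to [lambda]. *)
  have P'pos : ~ null lambda P'.
    move=> P'null; apply: Cpos.
    apply: sub_null (null_setU lambda_infinite P'null Enull) => p Cp.
    by have [|] := pselect (down E p); [right|left].
  by apply: (pos_ge _ P'pos) => p P'p; exists p.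
move=> X [XP' Xk].
(* [X] avoids [down E] and lies in the image of a single [a x]. Hence the remainder at [x] is
   contained in the union of this set and [down E], and the remainder is not null. *)
have XP'up : ~ null lambda (P' `\` up X).
  have [|B BD AB] := Dcov (e @^-1` X).
    split=> //; apply: card_le_lt_trans Xk.
    by apply/(card_le_funP p0); exists e => // x y _ _; exact: einj.
  have [] := subsets_lt2_bigcup _ BD; first by rewrite -aD; exists (a x0), x0.
  rewrite -aD => _ [x _ <-] Bax XN.
  apply: (Epos x); apply: sub_null (null_setU lambda_infinite XN Enull) => p [Cp Np].
  have [|NEp] := pselect (down E p); [by right|left; split=> // -[q [Xq qp]]].
  have [Cq NEq] := XP' _ Xq; apply: Np; exists q; split=> //; split=> //.
  move: Cq; rewrite -eC => -[y _ yq]; exists y => //; apply/Bax/AB.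
  by rewrite /= yq.
split; last exact: pos_ge.
(* [C] attains the minimum, since it dominates all of [P]. *)
by exists C => // p _; exact: Ccof.
Qed.
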